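(* Let $k$ be a positive integer, let $\mathscr F$ be a $k$-hyperedge-colored hypergraph in which every hyperedge is incident with exactly three hinges, and let $g:V(\mathscr F)\to\mathbb N$ be a function such that for each $x\in V(\mathscr F)$: $g(x)\le 2$ implies $m_{\mathscr F}(x^3)=0$, and $g(x)=1$ implies $m_{\mathscr F}(x^2,y)=0$ for every $y\in V(\mathscr F)$. Then there exists a $3$-uniform $g$-detachment $\mathscr G$ (possibly with multiple hyperedges) of $\mathscr F$ with amalgamation function $\Psi:V(\mathscr G)\to V(\mathscr F)$, $g$ being the number function associated with $\Psi$, such that $\mathscr G$ (with the hyperedge-coloring inherited from $\mathscr F$) satisfies the following conditions: (A1) $d_{\mathscr G}(u)\approx d_{\mathscr F}(x)/g(x)$ for each $x\in V(\mathscr F)$ and each $u\in\Psi^{-1}(x)$; (A2) $d_{\mathscr G(j)}(u)\approx d_{\mathscr F(j)}(x)/g(x)$ for each $x\in V(\mathscr F)$, each $u\in\Psi^{-1}(x)$ and each $j\in\{1,\ldots,k\}$; (A3) $m_{\mathscr G}(u,v,w)\approx m_{\mathscr F}(x,y,z)/\tilde g(x,y,z)$ for every $x,y,z\in V(\mathscr F)$ (not necessarily distinct) with $g(x)\ge 3$ if $x=y=z$, and $g(x)\ge 2$ if $|\{x,y,z\}|=2$ (where in this case $x$ denotes the vertex that occurs twice in the triple), and every triple of distinct vertices $u,v,w$ of $\mathscr G$ with $u\in\Psi^{-1}(x)$, $v\in\Psi^{-1}(y)$ and $w\in\Psi^{-1}(z)$; (A4) $m_{\mathscr G(j)}(u,v,w)\approx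 m_{\mathscr F(j)}(x,y,z)/\tilde g(x,y,z)$ for every $x,y,z\in V(\mathscr F)$ (not necessarily distinct) with $g(x)\ge 3$ if $x=y=z$, and $g(x)\ge 2$ if $|\{x,y,z\}|=2$ (where in this case $x$ denotes the vertex that occurs twice in the triple), every triple of distinct vertices $u,v,w$ of $\mathscr G$ with $u\in\Psi^{-1}(x)$, $v\in\Psi^{-1}(y)$ and $w\in\Psi^{-1}(z)$, and each $j\in\{1,\ldots,k\}$.
   Context: $\mathbb N$ denotes the set of positive integers. For real numbers $a,b$, $a\approx b$ means $\lfloor b\rfloor\le a\le\lceil b\rceil$ (this relation is not symmetric). A hypergraph $\mathscr G$ is a quintuple $(V(\mathscr G),E(\mathscr G),H(\mathscr G),\psi,\phi)$ where $V(\mathscr G),E(\mathscr G),H(\mathscr G)$ are disjoint finite sets (of vertices, hyperedges and hinges, respectively), $\psi:H(\mathscr G)\to V(\mathscr G)$ is a function and $\phi:H(\mathscr G)\to E(\mathscr G)$ is a surjection. A hinge $h$ is incident with the vertex $\psi(h)$ and with the hyperedge $\phi(h)$, and the vertex $\psi(h)$ and the hyperedge $\phi(h)$ are then incident with each other. (Thus a hypergraph is a bipartite multigraph between vertices and hyperedges whose edges are the hinges; a hyperedge may be attached to the same vertex by several hinges.) The degree $d_{\mathscr G}(v)$ of a vertex $v$ is the number of hinges incident with $v$. The size $|e|$ of a hyperedge $e$ is the number of distinct vertices incident with $e$. Distinct hyperedges incident with the same set of vertices are called multiple hyperedges. The hypergraph $\mathscr G$ is $3$-uniform if every hyperedge $e$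 satisfies $|e|=|\phi^{-1}(e)|=3$, i.e. it has exactly three hinges and these are incident with three distinct vertices. Suppose every hyperedge of $\mathscr G$ is incident with exactly three hinges. For (not necessarily distinct) vertices $u,v,w$, $m_{\mathscr G}(u,v,w)$ is the number of hyperedges whose three hinges are attached to $u,v,w$ counted with multiplicity, i.e. the hyperedges $e$ such that the multiset $\{\psi(h):h\in\phi^{-1}(e)\}$ equals the multiset $\{u,v,w\}$. One writes $m_{\mathscr G}(u^3)=m_{\mathscr G}(u,u,u)$ and $m_{\mathscr G}(u^2,v)=m_{\mathscr G}(u,u,v)$. A $k$-hyperedge-coloring of $\mathscr G$ is a mapping $E(\mathscr G)\to\{1,\ldots,k\}$; no further condition is imposed. $\mathscr G(j)$ denotes the sub-hypergraph with vertex set $V(\mathscr G)$ whose hyperedges are those of color $j$, together with all their hinges. If $\mathscr G=(W,E,H,\psi,\phi)$ is a hypergraph and $\Psi$ is a function from $W$ onto a set $V$, then the hypergraph $\mathscr F=(V,E,H,\Psi\circ\psi,\phi)$ is called an amalgamation of $\mathscr G$, $\mathscr G$ is called a detachment of $\mathscr F$, and $\Psi$ is the amalgamation function. The associated number function is $g:V\to\mathbb N$, $g(x)=|\Psi^{-1}(x)|$, and $\mathscr G$ is then called a $g$-detachment of $\mathscr F$. Since $\mathscr F$ and $\mathscr G$ have the same hyperedges, a coloring of the hyperedges of one is a coloring of the hyperedges of the other. For $g:V(\mathscr F)\to\mathbb N$, $\tilde g$ is the symmetric function on $V(\mathscr F)^3$ such that for distinct $x,y,z\in V(\mathscr F)$: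 $\tilde g(x,x,x)=\binom{g(x)}{3}$, $\tilde g(x,x,y)=\binom{g(x)}{2}g(y)$, and $\tilde g(x,y,z)=g(x)g(y)g(z)$. *)

(* Defs.v *)
From mathcomp Require Import all_boot all_order all_algebra.

Set Implicit Arguments.
Unset Strict Implicit.
Unset Printing Implicit Defensive.

Import Order.TTheory GRing.Theory Num.Theory.
Local Open Scope ring_scope.

(* This relation is not symmetric: the bounds are the floor and ceiling of b. *)
Definition approx (R : archiRealFieldType) (a b : R) : Prop :=
  (Num.floor b)%:~R <= a <= (Num.ceil b)%:~R.

(* The sets of vertices, hyperedges and hinges are parameters, so that a
   hypergraph and its detachments literally share E and H. Disjointness of the
   three sets is automatic, since they are distinct types. *)
Record hypergraph (V E H : finType) := Hypergraph {
  psi : H -> V;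
  phi : H -> E;
  phi_surj : forall e : E, exists h : H, phi h = e
}.

Definition degree (V E H : finType) (F : hypergraph V E H) (v : V) : nat :=
  #|[set h | psi F h == v]|.

Definition hinges (V E H : finType) (F : hypergraph V E H) (e : E) : {set H} :=
  [set h | phi F h == e].

Definition hyperedge_size (V E H : finType) (F : hypergraph V E H) (e : E) :
    nat :=
  #|[set psi F h | h in hinges F e]|.

Definition three_hinged (V E H : finType) (F : hypergraph V E H) : Prop :=
  forall e : E, #|hinges F e| = 3%N.

Definition three_uniform (V E H : finType) (F : hypergraph V E H) : Prop :=
  forall e : E, hyperedge_size F e = 3%N /\ #|hinges F e| = 3%N.

(* perm_eq compares the two lists of vertices as multisets; the first one keeps
   the repetitions coming from several hinges at the same vertex. *)
Definition mult (V E H : finType) (F : hypergraph V E H) (u v w : V) : nat :=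
  #|[set e | perm_eq [seq psi F h | h in hinges F e] [:: u; v; w]]|.

Section ColorClass.
Variables (V E H : finType) (F : hypergraph V E H) (k : nat) (c : E -> 'I_k).
Variable j : 'I_k.

Definition color_psi (h : {h : H | c (phi F h) == j}) : V := psi F (val h).

Definition color_phi (h : {h : H | c (phi F h) == j}) : {e : E | c e == j} :=
  exist _ (phi F (val h)) (valP h).

Lemma color_phi_surj (e : {e : E | c e == j}) : exists h, color_phi h = e.
Proof.
have [h he] := phi_surj F (val e).
have ch : c (phi F h) == j by rewrite he (valP e).
by exists (exist _ h ch); apply: val_inj.
Qed.

(* The sub-hypergraph F(j): all the vertices, the hyperedges of color j, and
   their hinges. *)
Definition color_class : hypergraph V {e : E | c e == j}
    {h : H | c (phi F h) == j} :=
  Hypergraph color_psi color_phi_surj.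
End ColorClass.

Definition amalgamation_function (V W E H : finType) (G : hypergraph W E H)
    (F : hypergraph V E H) (Psi : W -> V) : Prop :=
  [/\ forall x : V, exists u : W, Psi u = x,
      forall h : H, psi F h = Psi (psi G h)
    & forall h : H, phi F h = phi G h].

Definition number_function (V W : finType) (Psi : W -> V) (x : V) : nat :=
  #|[set u | Psi u == x]|.

Definition gtilde (V : finType) (g : V -> nat) (x y z : V) : nat :=
  if x == y then
    if y == z then 'C(g x, 3) else ('C(g x, 2) * g z)%N
  else if y == z then ('C(g y, 2) * g x)%N
  else if x == z then ('C(g x, 2) * g y)%N
  else (g x * g y * g z)%N.

(* If the triple has exactly two distinct entries, the bound 2 applies to the
   entry that occurs twice, wherever it stands in the triple. *)
Definition admissible (V : finType) (g : V -> nat) (x y z : V) : Prop :=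
  [/\ x = y -> y = z -> (3 <= g x)%N,
      x = y -> y <> z -> (2 <= g x)%N,
      y = z -> x <> y -> (2 <= g y)%N
    & x = z -> x <> y -> (2 <= g x)%N].

(* Main.v *)
(* The vertices of F are split off one at a time: from a vertex x with g x > 1 a
   new vertex is detached that takes over a set of hinges of size about 1 / g x
   of the hinges at x, and g x decreases by one.  The hinges to move must be
   balanced in two laminar families at once: the hinges at x, by color; and the
   hinges at x, by the type of their hyperedge, then by type and color, then by
   hyperedge.  Such a set exists because a laminar family can be halved along a
   matching of its elements and the union of two matchings is bipartite.  The
   conditions of the theorem amount to integer bounds a * g x <= d <= b * g x
   (and likewise for multiplicities), which each step preserves. *)
Require Import Defs.
From mathcomp Require Import all_boot all_order all_algebra.
From mathcomp Require Import zify.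

Set Implicit Arguments.
Unset Strict Implicit.
Unset Printing Implicit Defensive.

Import Order.TTheory GRing.Theory Num.Theory.
Local Open Scope ring_scope.

(** With [a <= b], moving the two terms apart by [k] on each side raises the sum of squares by
    [2k(b - a + k)], which vanishes only for [k = 0]. The equality case yields the strict decrease
    in [laminar_equitable]. *)
Lemma balanced_sqr_sum (a b c d : nat) :
  (a + b = c + d -> a <= b.+1 -> b <= a.+1 ->
  a ^ 2 + b ^ 2 <= c ^ 2 + d ^ 2 ?= iff (c <= d.+1) && (d <= c.+1))%N.
Proof.
wlog leab : a b / (a <= b)%N.
  move=> hw; case/orP: (leq_total a b) => [/hw //|/hw h e l1 l2].
  by rewrite (addnC (a ^ 2)%N); apply: h; rewrite ?(addnC b).
wlog lecd : c d / (c <= d)%N.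
  move=> hw; case/orP: (leq_total c d) => [/hw //|/hw h e l1 l2].
  by rewrite (addnC (c ^ 2)%N) andbC; apply: h; rewrite ?(addnC d).
move=> e _ leba; have [k ek] : exists k, a = (c + k)%N by exists (a - c)%N; lia.
have dk : d = (b + k)%N by lia.
split; first by rewrite ek dk; nia.
by case: k => [|k] in ek dk *; apply/eqP/idP; nia.
Qed.

(** * Matchings, laminar families and balanced subsets *)

Section Laminar.
Local Open Scope nat_scope.
Variable T : finType.
Implicit Types (U X P Q : {set T}) (A B : {set {set T}}) (s t : T -> T).

(** A matching is encoded as an involution of [U]; its fixed points are the unmatched elements. *)
Definition matching_on U s := {in U, forall x, (s x \in U) /\ s (s x) = x}.

Definition alternates U s X :=
  {in U, forall x, s x != x -> (s x \in X) = (x \notin X)}.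

(** From each edge, take the end that comes first in the enumeration of [T]. *)
Lemma matching_alternates U s :
  matching_on U s -> exists X, alternates U s X.
Proof.
move=> ms; exists [set x | enum_rank x < enum_rank (s x)] => x xU sx.
have [_ ssx] := ms x xU; rewrite !inE ssx -leqNgt ltn_neqAle.
by rewrite (inj_eq val_inj) (inj_eq enum_rank_inj) sx.
Qed.

(* By induction on [#|U|], contracting an edge [{x, s x}]. *)
Lemma two_matchings_alternate U s t :
  matching_on U s -> matching_on U t ->
  exists X, alternates U s X /\ alternates U t X.
Proof.
have [n] := ubnP #|U|; elim: n U s t => // n IHn U s t leUn ms mt.
have [/exists_inP[x xU sx] | /exists_inPn sid] :=
    boolP [exists x in U, s x != x]; last first.
  have [X aX] := matching_alternates mt; exists X; split=> // x /sid.
  by rewrite negbK => /eqP->; rewrite eqxx.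
have [yU syx] := ms x xU; set y := s x in sx yU syx.
set U' := U :\ x :\ y.
have inU' z : (z \in U') = [&& z != y, z != x & z \in U] by rewrite !inE.
(* [t'] joins the other ends of the two [t]-edges leaving the contracted
   [s]-edge [{x, y}]. *)
pose t' z := if t z == x then (if t y == y then z else t y)
             else if t z == y then (if t x == x then z else t x) else t z.
have tinj a b : a \in U -> b \in U -> t a = t b -> a = b.
  by move=> /mt[_ ta] /mt[_ tb] tab; rewrite -ta tab tb.
have sinj a b : a \in U -> b \in U -> s a = s b -> a = b.
  by move=> /ms[_ sa] /ms[_ sb] sab; rewrite -sa sab sb.
have [txU ttx] := mt x xU; have [tyU tty] := mt y yU.
have ms' : matching_on U' s.
  move=> z; rewrite inU' => /and3P[zy zx zU]; have [szU ssz] := ms z zU.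
  split=> //; rewrite inU' szU andbT; apply/andP; split.
    by apply: contra_neq zx => szy; apply: sinj.
  by apply: contra_neq zy => szx; rewrite -ssz szx.
have mt' : matching_on U' t'.
  move=> z; rewrite inU' => /and3P[zy zx zU]; have [tzU ttz] := mt z zU.
  rewrite /t'; case: (eqVneq (t z) x) => [tzx|tzx].
    have ztx : z = t x by rewrite -tzx ttz.
    case: (eqVneq (t y) y) => [tyy|tyy].
      by rewrite inU' zy zx zU tzx ?eqxx ?tyy ?eqxx.
    have tyx : t y != x.
      by apply: contra_neq zy => tyx; apply: tinj => //; rewrite tzx.
    rewrite inU' tyU tyy tyx tty (negPf sx) eqxx -ztx (negPf zx).
    by split.
  case: (eqVneq (t z) y) => [tzy|tzy].
    have zty : z = t y by rewrite -tzy ttz.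
    case: (eqVneq (t x) x) => [txx|txx].
      by rewrite inU' zy zx zU tzy ?eqxx (negPf sx) ?txx ?eqxx.
    have txy : t x != y.
      by apply: contra_neq zx => txy; apply: tinj => //; rewrite tzy.
    by rewrite inU' txU txy txx ttx eqxx -zty (negPf zy).
  rewrite inU' tzy tzx tzU ttz (negPf zx) (negPf zy); split=> //.
have [|X' [asX atX]] := IHn U' s t' _ ms' mt'.
  have yUx : y \in U :\ x by rewrite !inE sx.
  move: leUn; rewrite (cardsD1 x) xU (cardsD1 y) yUx /U' !add1n.
  by move/ltnW; rewrite ltnS.
(* [bx] says whether [x] is selected; [y] gets the opposite. It is forced by the outer neighbour
   [t x], failing that by [t y], and is free if neither lies in [U']. *)
pose bx := if t x \in U' then t x \notin X'
           else if t y \in U' then t y \in X' else true.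
exists [set z | if z == x then bx else if z == y then ~~ bx else z \in X'].
(* If both outer neighbours exist, [t'] joins them, so [X'] separates them and their demands on [bx]
   agree. *)
have by_ : t y \in U' -> ~~ bx = (t y \notin X').
  move=> tyU'; rewrite /bx tyU'; case: ifP => // txU'.
  congr (~~ _); have := atX _ txU'.
  rewrite /t' ttx eqxx; move: (tyU'); rewrite inU' => /andP[/negPf-> _] -> //.
  apply: contraNneq sx => /tinj -> //.
split=> z zU; rewrite !inE.
  case: (eqVneq z x) => [->|zx]; first by rewrite -/y (negPf sx) eqxx.
  case: (eqVneq z y) => [->|zy]; first by rewrite syx eqxx negbK.
  have zU' : z \in U' by rewrite inU' zy zx.
  move=> /(asX z zU') <-; have [] := ms' z zU'.
  by rewrite inU' => /and3P[/negPf-> /negPf-> _].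
case: (eqVneq z x) => [-> txx|zx].
  rewrite (negPf txx); case: (eqVneq (t x) y) => // txy.
  by rewrite /bx inU' txy txx txU negbK.
case: (eqVneq z y) => [-> tyy|zy].
  rewrite (negPf tyy) negbK; case: (eqVneq (t y) x) => // tyx.
  by apply: negb_inj; rewrite by_ // inU' tyy tyx.
have zU' : z \in U' by rewrite inU' zy zx.
have [tzU ttz] := mt z zU.
case: (eqVneq (t z) x) => [tzx|tzx] tzz.
  have ztx : t x = z by rewrite -tzx ttz.
  by rewrite /bx ztx zU'.
case: (eqVneq (t z) y) => [tzy|tzy].
  have zty : t y = z by rewrite -tzy ttz.
  by rewrite by_ zty.
have := atX z zU'; rewrite /t' (negPf tzx) (negPf tzy); exact.
Qed.

Definition laminar A := {in A &, forall P Q,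
  [|| P \subset Q, Q \subset P | [disjoint P & Q]]}.

(* Match two elements of a minimal member of [A] that has two unmatched ones: a
   member that separates them has no other unmatched element. *)
Lemma laminar_matching A U : laminar A ->
  exists2 s, matching_on U s &
    {in A, forall P, #|[set x in P :&: U | (s x == x) || (s x \notin P)]| <= 1}.
Proof.
move=> lA; have [n] := ubnP #|U|; elim: n U => // n IHn U leUn.
have [/exists_inP[P0 P0A P0U] | /exists_inPn sm] :=
    boolP [exists P in A, 1 < #|P :&: U|]; last first.
  exists id => // P /sm; rewrite -leqNgt; apply: leq_trans.
  by apply: subset_leq_card; apply/subsetP=> x; rewrite inE => /andP[].
have P0h : (P0 \in A) && (1 < #|P0 :&: U|) by rewrite P0A.
case: (@arg_minnP _ P0 (fun P => (P \in A) && (1 < #|P :&: U|))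
                  (fun P => #|P|) P0h) => P /andP[PA PU] Pmin.
have /card_gt1P[x [y [xPU yPU xy]]] := PU.
move: xPU yPU; rewrite !inE => /andP[xP xU] /andP[yP yU].
(* By laminarity, a member that separates two elements of [P] is a proper subset of [P], so
   minimality applies to it. *)
have small Q a b : Q \in A -> a \in P -> b \in P -> a \in Q -> b \notin Q ->
    #|Q :&: U| <= 1.
  move=> QA aP bP aQ bQ; rewrite leqNgt; apply/negP => QU.
  have := Pmin Q; rewrite QA QU => /(_ isT) lePQ.
  case/or3P: (lA _ _ PA QA) => [/subsetP/(_ b bP)|sQP|].
  - by rewrite (negPf bQ).
  - have : Q \proper P by rewrite properE sQP; apply/subsetPn; exists b.
    by move/proper_card; rewrite ltnNge lePQ.
  - by move/pred0P/(_ a); rewrite /= aP aQ.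
have [|s ms sA] := IHn (U :\ x :\ y).
  have yUx : y \in U :\ x by rewrite !inE eq_sym xy.
  move: leUn; rewrite (cardsD1 x) xU (cardsD1 y) yUx !add1n.
  by move/ltnW; rewrite ltnS.
pose s' z := if z == x then y else if z == y then x else s z.
have s'x : s' x = y by rewrite /s' eqxx.
have s'y : s' y = x by rewrite /s' eqxx eq_sym (negPf xy).
exists s'.
  move=> z zU; rewrite {1 3}/s'.
  case: (eqVneq z x) => [->|zx]; first by rewrite s'y.
  case: (eqVneq z y) => [->|zy]; first by rewrite s'x.
  have [] := ms z; first by rewrite !inE zy zx.
  rewrite !inE => /and3P[szy szx szU] ssz.
  by rewrite /s' (negPf szy) (negPf szx).
move=> Q QA.
have badQ :
    #|[set z in Q :&: U | (s' z == z) || (s' z \notin Q)]| <= #|Q :&: U|.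
  by apply: subset_leq_card; apply/subsetP=> z; rewrite inE => /andP[].
(* If [Q] contains both or neither of [x] and [y], its exceptional elements for [s'] are already
   exceptional for [s]; if it separates them, [small] applies. *)
case xQ : (x \in Q); last first.
  case yQ : (y \in Q).
    by apply: leq_trans badQ _; apply: (small Q y x); rewrite ?xQ.
  apply: leq_trans (sA Q QA); apply: subset_leq_card; apply/subsetP=> z.
  rewrite !inE /s'; case: (eqVneq z x) => [->|zx]; first by rewrite xQ.
  by case: (eqVneq z y) => [->|zy]; first by rewrite yQ.
case yQ : (y \in Q); last first.
  by apply: leq_trans badQ _; apply: (small Q x y); rewrite ?yQ.
apply: leq_trans (sA Q QA); apply: subset_leq_card; apply/subsetP=> z.
rewrite !inE /s'; case: (eqVneq z x) => [->|zx].
  by rewrite yQ (eq_sym y) (negPf xy) andbF.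
case: (eqVneq z y) => [->|zy] //.
by rewrite xQ (negPf xy) andbF.
Qed.

(** Outside the exceptional set [D], the involution pairs up the elements of [P :&: U] among
    themselves, and [X] takes one of each pair. Only the at most one element of [D] can tip the
    balance. *)
Lemma alternates_card P U s X : matching_on U s -> alternates U s X ->
  #|[set x in P :&: U | (s x == x) || (s x \notin P)]| <= 1 ->
  #|P :&: U :&: X| <= #|P :&: U :\: X|.+1
    /\ #|P :&: U :\: X| <= #|P :&: U :&: X|.+1.
Proof.
move=> ms aX; set D := [set x in _ | _] => D1.
set G := (P :&: U) :\: D.
have sG x : x \in G -> [/\ x \in U, s x \in G, s (s x) = x & s x != x].
  rewrite !inE negb_and => /andP[h /andP[xP xU]].
  move: h; rewrite xP xU /= negb_or negbK => /andP[sx sxP].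
  have [sxU ssx] := ms x xU.
  by rewrite sxP sxU ssx xP eq_sym (negPf sx).
have le12 : #|G :&: X| <= #|G :\: X|.
  have inj : {in G :&: X &, injective s}.
    move=> a b /setIP[/sG[_ _ ssa _] _] /setIP[/sG[_ _ ssb _] _] sab.
    by rewrite -ssa sab ssb.
  rewrite -(card_in_imset inj); apply/subset_leq_card/subsetP => z.
  move=> /imsetP[a /setIP[/sG[aU sa _ na] aX'] ->].
  by rewrite inE sa andbT aX // negbK.
have le21 : #|G :\: X| <= #|G :&: X|.
  have inj : {in G :\: X &, injective s}.
    move=> a b /setDP[/sG[_ _ ssa _] _] /setDP[/sG[_ _ ssb _] _] sab.
    by rewrite -ssa sab ssb.
  rewrite -(card_in_imset inj); apply/subset_leq_card/subsetP => z.
  by move=> /imsetP[a /setDP[/sG[aU sa _ na] aX'] ->]; rewrite inE sa aX.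
have DPU : D \subset P :&: U by apply/subsetP=> x; rewrite inE => /andP[].
have eI : #|P :&: U :&: X| = #|G :&: X| + #|D :&: X|.
  rewrite -(cardsID D (P :&: U :&: X)) addnC; congr (_ + _).
    by rewrite /G setIDAC.
  by rewrite setIAC (setIidPr DPU).
have eD : #|P :&: U :\: X| = #|G :\: X| + #|D :\: X|.
  rewrite -(cardsID D (P :&: U :\: X)) addnC; congr (_ + _).
    by rewrite /G !setDDl setUC.
  by rewrite setIDAC (setIidPr DPU).
by move: D1; rewrite -(cardsID X D); lia.
Qed.

Lemma laminar_halving A B U : laminar A -> laminar B ->
  exists X, {in A :|: B, forall P,
    #|P :&: U :&: X| <= #|P :&: U :\: X|.+1
      /\ #|P :&: U :\: X| <= #|P :&: U :&: X|.+1}.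
Proof.
move=> /(@laminar_matching _ U)[s ms sA] /(@laminar_matching _ U)[t mt tB].
have [X [asX atX]] := two_matchings_alternate ms mt.
exists X => P /setUP[/sA|/tB]; exact: alternates_card.
Qed.

(* Among all colorings, one that minimizes the sum of the squares of the
   [#|P :&: f @^-1: [set i]|] is equitable: otherwise halving the union of two
   color classes would decrease this sum. *)
Lemma laminar_equitable n A B : laminar A -> laminar B ->
  exists f : T -> 'I_n.+1, {in A :|: B, forall P i j,
    #|P :&: f @^-1: [set i]| <= #|P :&: f @^-1: [set j]|.+1}.
Proof.
move=> lA lB.
pose N (f : T -> 'I_n.+1) P i := #|P :&: f @^-1: [set i]|.
pose pot (f : {ffun T -> 'I_n.+1}) :=
  \sum_(P in A :|: B) \sum_i N f P i ^ 2.
have [f _ fmin] := @arg_minnP _ [ffun => ord0] xpredT pot isT.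
exists f => P PAB i j; rewrite leqNgt; apply/negP => Pij.
have ij : j != i by apply: contraTneq Pij => ->; rewrite ltnNge ltnW.
have [X halfX] := laminar_halving (f @^-1: [set i; j]) lA lB.
pose f' := [ffun x => if f x \in [set i; j] then (if x \in X then i else j)
                      else f x].
have Ni Q : N f' Q i = #|Q :&: f @^-1: [set i; j] :&: X|.
  congr #|pred_of_set _|; apply/setP => x; rewrite !inE ffunE !inE -andbA.
  case: (x \in Q) => //=; case: (eqVneq (f x) i) => /= fxi.
    by case: (x \in X); rewrite ?eqxx // (negPf ij).
  case: (eqVneq (f x) j) => /= fxj; last by rewrite (negPf fxi).
  by case: (x \in X); rewrite ?eqxx // (negPf ij).
have Nj Q : N f' Q j = #|Q :&: f @^-1: [set i; j] :\: X|.
  congr #|pred_of_set _|; apply/setP => x; rewrite !inE ffunE !inE andbC.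
  case: (x \in Q); rewrite ?andbF //= ?andbT; case: (eqVneq (f x) i) => /= fxi.
    by case: (x \in X); rewrite ?eqxx // (eq_sym i) (negPf ij).
  case: (eqVneq (f x) j) => /= fxj; last by rewrite (negPf fxj) andbF.
  by case: (x \in X); rewrite ?eqxx // eq_sym (negPf ij).
have Nij Q : N f' Q i + N f' Q j = N f Q i + N f Q j.
  rewrite Ni Nj cardsID /N -cardsUI -setIUr; set Z := _ :&: _ :&: _.
  have -> : Z = set0.
    apply/setP => x; rewrite !inE; case: (x \in Q) => //=.
    by case: (eqVneq (f x) i) => //= ->; rewrite eq_sym (negPf ij).
  rewrite cards0 addn0; congr #|pred_of_set _|; congr (_ :&: _).
  by apply/setP => x; rewrite !inE.
have Nk Q l : (l != i) && (l != j) -> N f' Q l = N f Q l.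
  move=> /andP[li lj]; congr #|pred_of_set _|; apply/setP => x.
  rewrite !inE ffunE !inE; case: (x \in Q) => //=.
  case: (eqVneq (f x) i) => [->|] /=.
    by case: (x \in X); rewrite ?(eq_sym i) ?(eq_sym j) (negPf li) ?(negPf lj).
  case: (eqVneq (f x) j) => [->|] //=.
  by case: (x \in X); rewrite ?(eq_sym i) ?(eq_sym j) (negPf lj) ?(negPf li).
have split2 (h : T -> 'I_n.+1) Q : \sum_l N h Q l ^ 2 =
    (N h Q i ^ 2 + N h Q j ^ 2) + \sum_(l | (l != i) && (l != j)) N h Q l ^ 2.
  by rewrite (bigD1 i) //= (bigD1 j) //= addnA.
have eqrest Q : \sum_(l | (l != i) && (l != j)) N f' Q l ^ 2 =
    \sum_(l | (l != i) && (l != j)) N f Q l ^ 2.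
  by apply: eq_bigr => l /(Nk Q) ->.
have leQ Q : Q \in A :|: B -> \sum_l N f' Q l ^ 2 <= \sum_l N f Q l ^ 2.
  move=> /halfX; rewrite -Ni -Nj !split2 eqrest leq_add2r.
  by case=> le1 le2; rewrite (balanced_sqr_sum (Nij Q)).
(* Equality would force the two old classes to differ by at most one on [P], against [Pij]. *)
have ltP : \sum_l N f' P l ^ 2 < \sum_l N f P l ^ 2.
  have := halfX P PAB; rewrite -Ni -Nj !split2 eqrest ltn_add2r.
  case=> le1 le2; have le := balanced_sqr_sum (Nij P) le1 le2.
  by rewrite ltn_neqAle !le andbT negb_and -ltnNge Pij.
have := fmin f' isT; rewrite leqNgt => /negP[].
rewrite /pot (bigD1 P) //= [ltnRHS](bigD1 P) //= -addSn leq_add //.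
by apply: leq_sum => Q /andP[/leQ].
Qed.

(** One class of an equitable coloring with [n] colors serves: if it had fewer than [a] elements of
    [P], every class would have at most [a], and the total would fall below [a * n]. The upper bound
    is symmetric. *)
Lemma laminar_fraction n A B : 0 < n -> laminar A -> laminar B ->
  exists X, {in A :|: B, forall P a,
    (a * n <= #|P| -> a <= #|P :&: X|) /\ (#|P| <= a * n -> #|P :&: X| <= a)}.
Proof.
case: n => // n _ lA lB; have [f ef] := laminar_equitable n lA lB.
exists (f @^-1: [set ord0]) => P PAB a.
have sumP : #|P| = \sum_(i < n.+1) #|P :&: f @^-1: [set i]|.
  rewrite -sum1_card (partition_big f xpredT) //=; apply: eq_bigr => i _.
  by rewrite -sum1_card; apply: eq_bigl => x; rewrite !inE.
have sumc b : b * n.+1 = \sum_(i < n.+1) b.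
  by rewrite sum_nat_const card_ord mulnC.
split; apply: contraTT; rewrite -!ltnNge => lt.
  rewrite sumP sumc (bigD1 ord0) //= [ltnRHS](bigD1 ord0) //= -addSn leq_add //.
  by apply: leq_sum => i _; apply: leq_trans (ef P PAB i ord0) lt.
rewrite sumP sumc (bigD1 ord0) //= [ltnRHS](bigD1 ord0) //= -addSn leq_add //.
by apply: leq_sum => i _; rewrite -ltnS; apply: leq_trans lt (ef P PAB ord0 i).
Qed.

End Laminar.

(* If [0 < g], this says floor (d / g) * g' <= d' <= ceil (d / g) * g'; unlike
   [approx], it is transitive. *)
Definition shares (d g d' g' : nat) : Prop := (forall a,
  (a * g <= d -> a * g' <= d') /\ (d <= a * g -> d' <= a * g'))%N.

Lemma shares_refl d g : shares d g d g.
Proof. by []. Qed.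

Lemma shares_trans d g d1 g1 d2 g2 :
  shares d g d1 g1 -> shares d1 g1 d2 g2 -> shares d g d2 g2.
Proof.
move=> s1 s2 a; have [l1 u1] := s1 a; have [l2 u2] := s2 a.
by split=> [/l1/l2|/u1/u2].
Qed.

(* With [r] the distance from [m] to [a * A], a set of size [t * m] is at
   distance at most [r * G] from [a * B * G], since [t <= G]. *)
Lemma shares_split t m G x A B :
  (shares (t * m) G x 1 -> t <= G -> 0 < G -> G * B = t * A ->
  shares m A x B /\ shares m A (m - x) (A - B))%N.
Proof.
move=> sx tG G0 GB; split=> a; split=> h.
- by have [+ _] := sx (a * B)%N; rewrite muln1; apply; nia.
- by have [_ +] := sx (a * B)%N; rewrite muln1; apply; nia.
- have [r er] : exists r, m = (a * A + r)%N by exists (m - a * A)%N; lia.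
  by have [_ +] := sx (a * B + r)%N; rewrite muln1 mulnBr; nia.
- have [r er] : exists r, (m + r = a * A)%N by exists (a * A - m)%N; lia.
  by have [+ _] := sx (a * B - r)%N; rewrite muln1 mulnBr; nia.
Qed.

(** * Weighted detachments and their composition *)

Section Detachment.
Local Open Scope nat_scope.
Variables (E H J : finType) (phi : H -> E) (c : E -> J).
Implicit Types (e : E) (h : H) (j : option J).

(* [None] stands for the whole hypergraph, [Some j] for its color class [j]. *)
Definition in_class j e := if j is Some i then c e == i else true.

Section Hypergraph.
Variable V : finType.
Implicit Types (p : H -> V) (g : V -> nat) (tau : {ffun V -> nat}).

(* The multiset of the vertices of [e], as a function. *)
Definition edge_type p e : {ffun V -> nat} :=
  [ffun x => #|[set h | (phi h == e) && (p h == x)]|].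

Definition type_mult p j tau :=
  #|[set e | in_class j e && (edge_type p e == tau)]|.

Definition class_degree p j x :=
  #|[set h | in_class j (phi h) && (p h == x)]|.

(* For a multiset of size three this is [gtilde], see [type_weight_gtilde]. *)
Definition type_weight g tau := \prod_x 'C(g x, tau x).
End Hypergraph.

(** The push-forward along [Psi]: the effect of amalgamation on a multiset of vertices, and also on
    a number function. *)
Definition push (V W : finType) (Psi : W -> V) (s : W -> nat) :
  {ffun V -> nat} := [ffun x => \sum_(w | Psi w == x) s w].

Lemma push_comp (V W X : finType) (Psi : W -> V) (Phi : X -> W) s :
  push Psi (push Phi s) = push (Psi \o Phi) s.
Proof.
apply/ffunP=> x; rewrite !ffunE.
rewrite (partition_big Phi (fun w => Psi w == x)) //=.
apply: eq_bigr => w /eqP wx; rewrite ffunE; apply: eq_bigl => u.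
by case: (eqVneq (Phi u) w) => [->|]; rewrite ?wx ?eqxx ?andbF.
Qed.

Lemma push_le (V W : finType) (Psi : W -> V) (s s' : W -> nat) :
  (forall w, s w <= s' w) -> forall x, push Psi s x <= push Psi s' x.
Proof. by move=> le x; rewrite !ffunE; apply: leq_sum. Qed.

Lemma push_edge_type (V W : finType) (Psi : W -> V) (q : H -> W) e :
  push Psi (edge_type q e) = edge_type (Psi \o q) e.
Proof.
apply/ffunP=> x; rewrite !ffunE -sum1_card.
rewrite (partition_big q (fun w => Psi w == x)) /=; last first.
  by move=> h; rewrite inE => /andP[].
apply: eq_bigr => w /eqP wx; rewrite ffunE -sum1_card; apply: eq_bigl => h.
rewrite !inE; case: (eqVneq (q h) w) => [->|]; last by rewrite !andbF.
by rewrite wx eqxx !andbT.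
Qed.

(** The invariant of the iteration: in the partial detachment [q], a vertex [w] still stands for
    [g' w] final vertices. The bounds are put as [shares] so that successive detachments compose.
    Once [g'] is constantly one, [detaches_edge] says that the hinges of a hyperedge lie at distinct
    vertices. *)
Record detaches (V W : finType) (p : H -> V) (g : V -> nat)
    (q : H -> W) (g' : W -> nat) (Psi : W -> V) : Prop := Detaches {
  detaches_comp : p =1 Psi \o q;
  detaches_weight : forall x, g x = push Psi g' x;
  detaches_edge : forall e w, edge_type q e w <= g' w;
  detaches_degree : forall j w,
    shares (class_degree p j (Psi w)) (g (Psi w)) (class_degree q j w) (g' w);
  detaches_mult : forall j (s : {ffun W -> nat}), (forall w, s w <= g' w) ->
    shares (type_mult p j (push Psi s)) (type_weight g (push Psi s))
           (type_mult q j s) (type_weight g' s) }.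

Lemma push_id (V : finType) (s : V -> nat) : push id s =1 s.
Proof. by move=> x; rewrite ffunE big_pred1_eq. Qed.

Lemma detaches_refl (V : finType) (p : H -> V) g :
  (forall e x, edge_type p e x <= g x) -> detaches p g p g id.
Proof.
move=> le; split=> // [x|j s _]; first by rewrite push_id.
have -> : push id s = s by apply/ffunP=> x; rewrite push_id.
exact: shares_refl.
Qed.

Lemma detaches_trans (V W X : finType) (p : H -> V) g (q : H -> W) g1
    (r : H -> X) g2 Psi Phi :
  detaches p g q g1 Psi -> detaches q g1 r g2 Phi ->
  detaches p g r g2 (Psi \o Phi).
Proof.
move=> [c1 w1 e1 d1 m1] [c2 w2 e2 d2 m2]; split=> // [h|x|j u|j s le].
- by rewrite c1 /= c2.
- rewrite w1 -push_comp !ffunE; apply: eq_bigr => w _; exact: w2.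
- exact: shares_trans (d1 _ _) (d2 _ _).
- rewrite -push_comp; apply: shares_trans (m2 j s le); apply: m1 => w.
  by rewrite w2; apply: push_le.
Qed.

Lemma big_option (R : Type) (idx : R) (op : Monoid.com_law idx) (V : finType)
    (F : option V -> R) :
  \big[op/idx]_w F w = op (F None) (\big[op/idx]_x F (Some x)).
Proof.
rewrite (bigD1 None) //=; congr (op _ _).
rewrite (reindex_omap Some id) /=; last by case.
by apply: eq_bigl => x; rewrite eqxx.
Qed.

(** * Splitting one vertex off [x0] *)

Section Step.
Variables (V : finType) (p : H -> V) (g : V -> nat) (x0 : V).
Hypothesis g0 : 0 < g x0.
Hypothesis edge_le : forall e x, edge_type p e x <= g x.

Let S (P : pred E) : {set H} := [set h | P (phi h) && (p h == x0)].

(** [fam_class] controls the degrees and [fam_type] the multiplicities. The members of [fam_type]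
    for single hyperedges keep the number of hinges of a hyperedge at a vertex within the weight of
    that vertex. *)
Let fam_class := [set S (in_class j) | j : option J].
Let fam_type := [set S (pred1 e) | e : E] :|:
  [set S (fun e' => in_class u.1 e' && (edge_type p e' == edge_type p u.2))
     | u : option J * E].

Let laminar_S (P Q : pred E) :
  [\/ subpred P Q, subpred Q P | forall e, P e -> ~~ Q e] ->
  [|| S P \subset S Q, S Q \subset S P | [disjoint S P & S Q]].
Proof.
case=> sub; apply/or3P; [apply: Or31|apply: Or32|apply: Or33].
- by apply/subsetP=> h; rewrite !inE => /andP[/sub-> ->].
- by apply/subsetP=> h; rewrite !inE => /andP[/sub-> ->].
- apply/pred0P=> h; rewrite /= !inE; apply/negbTE; rewrite negb_and.
  by case: (boolP (P _)) => //= /sub/negbTE->; rewrite orbT.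
Qed.

Let laminar_class : laminar fam_class.
Proof.
move=> _ _ /imsetP[j _ ->] /imsetP[i _ ->]; apply: laminar_S.
case: j i => [j|] [i|] /=; [|exact: Or31|exact: Or32|exact: Or31].
case: (eqVneq j i) => [->|ji]; first exact: Or31.
by apply: Or33 => e /eqP ->.
Qed.

Let laminar_type : laminar fam_type.
Proof.
move=> _ _ /setUP[]/imsetP[u _ ->] /setUP[]/imsetP[v _ ->]; apply: laminar_S.
- case: (eqVneq u v) => [->|uv]; first exact: Or31.
  by apply: Or33 => e /= /eqP ->.
- case uv: (in_class v.1 u && (edge_type p u == edge_type p v.2)).
    by apply: Or31 => e /= /eqP ->.
  by apply: Or33 => e /= /eqP ->; rewrite uv.
- case vu: (in_class u.1 v && (edge_type p v == edge_type p u.2)).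
    by apply: Or32 => e /= /eqP ->.
  by apply: Or33 => e /=; apply: contraL => /eqP ->; rewrite vu.
case: (eqVneq (edge_type p u.2) (edge_type p v.2)) => [->|uv]; last first.
  by apply: Or33 => e /andP[_ /eqP ->]; rewrite (negPf uv) andbF.
case: u v => [[i|] a] [[j|] b] /=.
- case: (eqVneq i j) => [->|ij]; first exact: Or31.
  by apply: Or33 => e /andP[/eqP-> _]; rewrite (negPf ij).
- by apply: Or31 => e /andP[].
- by apply: Or32 => e /andP[].
- exact: Or31.
Qed.

Let exists_share : exists X,
  [/\ forall j, shares #|S (in_class j)| (g x0) #|S (in_class j) :&: X| 1,
      forall e, shares #|S (pred1 e)| (g x0) #|S (pred1 e) :&: X| 1
    & forall j tau,
        let P := S (fun e => in_class j e && (edge_type p e == tau)) in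
        shares #|P| (g x0) #|P :&: X| 1].
Proof.
have [X shX] := laminar_fraction g0 laminar_class laminar_type.
exists X; split=> [j|e|j tau P] a; rewrite muln1.
- by apply: shX; rewrite inE imset_f.
- by apply: shX; rewrite !inE [X in _ || (X || _)]imset_f ?orbT.
have [/existsP[e /eqP etau]|/existsPn notau] :=
    boolP [exists e, edge_type p e == tau].
  apply: shX; rewrite !inE; apply/orP; right; apply/orP; right.
  by apply/imsetP; exists (j, e) => //; rewrite /P -etau.
(* A type that no hyperedge has gives no member of [fam_type], but its set of hinges is empty. *)
have -> : P = set0.
  by apply/setP=> h; rewrite !inE (negPf (notau _)) andbF.
rewrite set0I !cards0; split=> //.
by rewrite !leqn0 muln_eq0 => /orP[//|]; rewrite eqn0Ngt g0.
Qed.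

(** [None] is the detached vertex; [odflt x0] is the amalgamation that merges it back into [x0]. *)
Definition split_weight (w : option V) :=
  if w is Some x then (if x == x0 then (g x0).-1 else g x) else 1.

Let push_Some s x : x != x0 -> push (odflt x0) s x = s (Some x).
Proof.
move=> xx0; rewrite ffunE big_mkcond big_option /= eq_sym (negPf xx0).
by rewrite -big_mkcond big_pred1_eq.
Qed.

Let push_None s : push (odflt x0) s x0 = s None + s (Some x0).
Proof.
by rewrite ffunE big_mkcond big_option /= eqxx -big_mkcond big_pred1_eq.
Qed.

(** The hinges of [X] at [x0] move to [None]. Degrees and hyperedge bounds follow from the shares of
    [X]. For multiplicities, each hyperedge of type [tau] has [tau x0] hinges at [x0] and loses at
    most one, so the moved hinges count the hyperedges that lose one; [shares_split] then treats
    both those that lose one and those that lose none. *)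
Lemma detaches_split : exists q : H -> option V,
  detaches p g q split_weight (odflt x0).
Proof.
have [X [shc she sht]] := exists_share.
pose q h := if (p h == x0) && (h \in X) then None else Some (p h).
have pq : p =1 odflt x0 \o q.
  by move=> h; rewrite /= /q; case: (eqVneq (p h) x0) => //= ->; case: ifP.
have qNone h : (q h == None) = (p h == x0) && (h \in X).
  by rewrite /q; case: ifP.
have qSome0 h : (q h == Some x0) = (p h == x0) && (h \notin X).
  rewrite /q; case: (eqVneq (p h) x0) => /= [->|px].
    by case: ifP; rewrite ?eqxx.
  by apply/eqP => -[] /eqP; rewrite (negPf px).
have qSome h x : x != x0 -> (q h == Some x) = (p h == x).
  rewrite /q; case: (eqVneq (p h) x0) => //= px xx0.
  rewrite px (eq_sym x0) (negPf xx0); case: ifP => // _.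
  by apply/eqP => -[] /eqP; rewrite eq_sym (negPf xx0).
have cNone (P : pred E) :
    #|[set h | P (phi h) && (q h == None)]| = #|S P :&: X|.
  by congr #|pred_of_set _|; apply/setP=> h; rewrite !inE qNone andbA.
have cSome0 (P : pred E) :
    #|[set h | P (phi h) && (q h == Some x0)]| = #|S P| - #|S P :&: X|.
  rewrite -cardsD; congr #|pred_of_set _|; apply/setP=> h.
  by rewrite !inE qSome0 andbA andbC.
have cSome (P : pred E) x : x != x0 ->
    #|[set h | P (phi h) && (q h == Some x)]| =
    #|[set h | P (phi h) && (p h == x)]|.
  move=> xx0; congr #|pred_of_set _|; apply/setP=> h.
  by rewrite !inE qSome.
have Se e : #|S (pred1 e)| = edge_type p e x0 by rewrite ffunE.
have etN e : edge_type q e None = #|S (pred1 e) :&: X|.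
  by rewrite ffunE (cNone (pred1 e)).
(* The case [t = 1], [A = G], [B = 1] of [shares_split]. *)
have splitg d d' : shares d (g x0) d' 1 ->
    shares d (g x0) d' 1 /\ shares d (g x0) (d - d') (g x0).-1.
  move=> sh; rewrite -[(g x0).-1]subn1; apply: (@shares_split 1 d (g x0)) => //.
    by rewrite mul1n.
  by rewrite muln1 mul1n.
(* A hyperedge has at most [1 * g x0] hinges at [x0], so its share at the new vertex is at most
   one. *)
have etN1 e : edge_type q e None <= 1.
  rewrite etN; have [_ /(_ _)] := she e 1; rewrite muln1; apply.
  by rewrite mul1n Se.
exists q; split=> //.
- move=> x; case: (eqVneq x x0) => [->|xx0].
    by rewrite push_None /= eqxx add1n prednK.
  by rewrite push_Some //= (negPf xx0).
- move=> e [x|] //=; case: eqP => [->|/eqP xx0].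
    rewrite ffunE (cSome0 (pred1 e)).
    have [_ /(_ 1)[_]] := splitg _ _ (she e); rewrite !mul1n; apply.
    by rewrite Se.
  by have := edge_le e x; rewrite !ffunE (cSome (pred1 e)).
- move=> j [x|] /=.
    case: (eqVneq x x0) => [->|xx0].
      by rewrite /class_degree cSome0; have [] := splitg _ _ (shc j).
    by rewrite /class_degree cSome //; apply: shares_refl.
  by rewrite /class_degree cNone; have [] := splitg _ _ (shc j).
move=> j s les; set tau := push _ s.
pose M := [set e | in_class j e && (edge_type p e == tau)].
pose P := S (fun e => in_class j e && (edge_type p e == tau)).
have pushq e : push (odflt x0) (edge_type q e) = edge_type p e.
  rewrite push_edge_type; apply/ffunP=> x; rewrite !ffunE.
  by congr #|pred_of_set _|; apply/setP=> h; rewrite !inE pq.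
(* Over a given type [tau], the new type is determined by the number of moved hinges. *)
have typeq e : (edge_type q e == s) =
    (edge_type p e == tau) && (edge_type q e None == s None).
  apply/eqP/andP => [es|[/eqP et /eqP eN]].
    by rewrite -pushq es.
  have et' x : push (odflt x0) (edge_type q e) x = tau x by rewrite pushq et.
  apply/ffunP=> -[x|] //; have := et' x; rewrite /tau.
  case: (eqVneq x x0) => [->|xx0]; first by rewrite !push_None eN => /addnI.
  by rewrite !push_Some.
have cardP (Y : {set H}) : #|P :&: Y| = \sum_(e in M) #|S (pred1 e) :&: Y|.
  rewrite -sum1_card (partition_big phi (fun e => e \in M)) /=; last first.
    by move=> h; rewrite !inE => /andP[/andP[]].
  apply: eq_bigr => e; rewrite inE => eM; rewrite -sum1_card.
  apply: eq_bigl => h; rewrite !inE.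
  by case: (eqVneq (phi h) e) => [->|]; rewrite ?eM ?andbT ?andbF.
have PT : #|P| = tau x0 * type_mult p j tau.
  rewrite -[P]setIT cardP mulnC /type_mult -/M -sum_nat_const.
  apply: eq_bigr => e; rewrite inE => /andP[_ /eqP et].
  by rewrite setIT Se et.
have PX : #|P :&: X| = #|[set e in M | edge_type q e None == 1]|.
  rewrite cardP -sum1_card big_mkcond [RHS]big_mkcond /=.
  apply: eq_bigr => e _; rewrite inE; case: (e \in M) => //=.
  by rewrite -etN; have := etN1 e; case: (edge_type q e None) => [|[]].
pose R := \prod_(x | x != x0) 'C(g x, tau x).
have wtau : type_weight g tau = R * 'C(g x0, tau x0).
  by rewrite /type_weight (bigD1 x0) //= mulnC.
have tau0 : tau x0 = s None + s (Some x0) by rewrite /tau push_None.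
have sN : s None <= 1 := les None.
have ws : type_weight split_weight s = R * 'C((g x0).-1, s (Some x0)).
  rewrite /type_weight big_option /= (bigD1 x0) //= eqxx.
  have -> : 'C(1, s None) = 1 by move: sN; case: (s None) => [|[]].
  rewrite mul1n mulnC; congr (_ * _).
  by apply: eq_bigr => x xx0; rewrite (negPf xx0) /tau push_Some.
have tauG : tau x0 <= g x0.
  rewrite tau0 -[leqRHS](prednK g0) -add1n leq_add //.
  by have := les (Some x0); rewrite /= eqxx.
(* [B] is the weight of the multiset obtained from [tau] by moving one of its copies of [x0] to
   [None], and zero if there is no copy to move. By the absorption identity for binomial
   coefficients, its proportion in [type_weight g tau] is [tau x0 / g x0]. *)
pose B := if tau x0 is t.+1 then R * 'C((g x0).-1, t) else 0.
have GB : g x0 * B = tau x0 * type_weight g tau.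
  rewrite /B wtau; case: (tau x0) => [|t]; first by rewrite mul0n muln0.
  by rewrite !(mulnCA _ R) mul_bin_diag.
have sh := sht j tau; rewrite /= -/P PT in sh.
have [sh1 sh0] := shares_split sh tauG g0 GB.
have : s None = 0 \/ s None = 1 by lia.
case=> esN.
  have -> : type_mult q j s = type_mult p j tau - #|P :&: X|.
    rewrite PX /type_mult -/M.
    have -> : [set e in M | edge_type q e None == 1] =
              M :&: [set e | edge_type q e None == 1].
      by apply/setP=> e; rewrite !inE.
    rewrite -cardsD; congr #|pred_of_set _|; apply/setP=> e.
    rewrite !inE typeq esN andbA andbC; congr (_ && _).
    by have := etN1 e; case: (edge_type q e None) => [|[]].
  have -> : type_weight split_weight s = type_weight g tau - B.
    rewrite ws wtau /B tau0 esN add0n; case: (s (Some x0)) => [|t].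
      by rewrite !bin0 subn0.
    (* Pascal's rule: the weights with and without a moved hinge add up to that of [tau]. *)
    rewrite -mulnBr -{2}(prednK g0) binS.
    by rewrite addnK.
  exact: sh0.
have -> : type_mult q j s = #|P :&: X|.
  rewrite PX /type_mult; congr #|pred_of_set _|; apply/setP=> e.
  by rewrite !inE typeq esN andbA.
suff -> : type_weight split_weight s = B by [].
by rewrite ws /B tau0 esN.
Qed.

End Step.

(** Induction on the total excess of [g] over one, which each split lowers; when there is no excess,
    the identity serves. *)
Lemma detaches_full (V : finType) (p : H -> V) (g : V -> nat) :
  (forall x, 0 < g x) -> (forall e x, edge_type p e x <= g x) ->
  exists (W : finType) (q : H -> W) (Psi : W -> V),
    detaches p g q (fun=> 1) Psi.
Proof.
have [n] := ubnP (\sum_x (g x).-1); elim: n V p g => // n IHn V p g.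
move=> ltn gpos le; have [/existsP[x0 gx0]|/existsPn g1] :=
    boolP [exists x, 1 < g x]; last first.
  have g1' x : g x = 1.
    by apply/eqP; rewrite eqn_leq gpos andbT leqNgt g1.
  exists V, p, id; have [c1 w1 e1 d1 m1] := detaches_refl le.
  split=> // [x|e x|j x|j s les].
  - by rewrite push_id.
  - by rewrite -(g1' x).
  - by rewrite -[X in shares _ _ _ X](g1' x).
  have -> : type_weight (fun=> 1) s = type_weight g s.
    by apply: eq_bigr => x _; rewrite g1'.
  by apply: m1 => x; rewrite g1'.
have [q dq] := detaches_split (gpos x0) le.
have [|w||W [r [Phi dr]]] := IHn _ q (split_weight g x0).
- rewrite -ltnS; apply: leq_ltn_trans ltn; rewrite big_option /= add0n.
  rewrite (bigD1 x0) //= [ltnRHS](bigD1 x0) //= eqxx -addSn leq_add //.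
    by move: gx0; case: (g x0) => [|[]].
  by apply: leq_sum => x /negPf->.
- by case: w => [x|] //=; case: ifP => // _; rewrite -subn1 subn_gt0.
- exact: detaches_edge dq.
- by exists W, r, (odflt x0 \o Phi); apply: detaches_trans dq dr.
Qed.

End Detachment.

(** * Translation between the hypergraph notions and edge types *)

Section Translation.
Local Open Scope nat_scope.

Lemma card_sig_set (T : finType) (P Q : pred T) :
  #|[set u : {x : T | P x} | Q (val u)]| = #|[set x | P x && Q x]|.
Proof.
rewrite -(card_imset _ val_inj); congr #|pred_of_set _|; apply/setP=> x.
rewrite inE; apply/imsetP/andP => [[u + ->]|[Px Qx]].
  by rewrite inE; split=> //; apply: valP.
by exists (exist _ x Px); rewrite ?inE.
Qed.

Lemma count_enum (T : finType) (A : {set T}) (P : pred T) :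
  count P (enum A) = #|[set x in A | P x]|.
Proof.
rewrite -size_filter cardE /enum_mem -filter_predI.
by congr size; apply: eq_filter => x; rewrite /= !inE andbC.
Qed.

Definition counts (V : finType) (s : seq V) : {ffun V -> nat} :=
  [ffun x => count_mem x s].

Lemma perm_eq_edge_type (V E H : finType) (F : hypergraph V E H) e s :
  perm_eq [seq psi F h | h in hinges F e] s =
  (edge_type (phi F) (psi F) e == counts s).
Proof.
have cnt x : count_mem x [seq psi F h | h in hinges F e] =
    edge_type (phi F) (psi F) e x.
  rewrite count_map count_enum ffunE; congr #|pred_of_set _|.
  by apply/setP=> h; rewrite !inE.
apply/idP/eqP => [/permP ps|ets].
  by apply/ffunP=> x; rewrite -cnt ps ffunE.
by apply/allP => x _ /=; rewrite cnt ets ffunE.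
Qed.

Section Classes.
Variables (V E H : finType) (F : hypergraph V E H) (k : nat) (c : E -> 'I_k).

Lemma multE u v w :
  mult F u v w = type_mult (phi F) c (psi F) None (counts [:: u; v; w]).
Proof.
by congr #|pred_of_set _|; apply/setP=> e; rewrite !inE perm_eq_edge_type.
Qed.

Lemma mult_color_class j u v w : mult (color_class F c j) u v w =
  type_mult (phi F) c (psi F) (Some j) (counts [:: u; v; w]).
Proof.
rewrite /type_mult /= -(card_sig_set (fun e => c e == j)).
congr #|pred_of_set _|; apply/setP=> e; rewrite !inE perm_eq_edge_type.
congr (_ == _); apply/ffunP=> x; rewrite !ffunE /=.
pose Q h := (phi F h == val e) && (psi F h == x).
transitivity #|[set h : {h : H | c (phi F h) == j} | Q (val h)]|.
  by congr #|pred_of_set _|; apply/setP=> h; rewrite !inE.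
rewrite (card_sig_set (fun h => c (phi F h) == j)).
congr #|pred_of_set _|; apply/setP=> h; rewrite !inE /Q.
by case: (eqVneq (phi F h) (val e)) => [->|]; rewrite ?(valP e) ?andbF.
Qed.

Lemma degree_color_class j x :
  degree (color_class F c j) x = class_degree (phi F) c (psi F) (Some j) x.
Proof.
pose Q h := psi F h == x.
by rewrite /class_degree /= -(card_sig_set (fun h => c (phi F h) == j) Q).
Qed.

End Classes.

Lemma push_counts (V W : finType) (Psi : W -> V) (s : seq W) :
  push Psi (counts s) = counts (map Psi s).
Proof.
apply/ffunP=> x; rewrite !ffunE; under eq_bigr do rewrite ffunE.
elim: s => [|u s IHs] /=; first by rewrite big1.
rewrite big_split IHs /=; congr (_ + _).
rewrite big_mkcond (bigD1 u) //= eqxx big1 ?addn0 //.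
by move=> w; rewrite eq_sym => /negPf->; case: ifP.
Qed.

Lemma type_weight_gtilde (V : finType) (g : V -> nat) x y z :
  type_weight g (counts [:: x; y; z]) = gtilde g x y z.
Proof.
have outside (P : pred V) : (forall w, P w -> [/\ w != x, w != y & w != z]) ->
    \prod_(w | P w) 'C(g w, counts [:: x; y; z] w) = 1.
  move=> sub; apply: big1 => w /sub[wx wy wz].
  by rewrite ffunE /= !(eq_sym _ w) (negPf wx) (negPf wy) (negPf wz) bin0.
rewrite /type_weight (bigD1 x) //= ffunE /= eqxx /gtilde.
case: (eqVneq x y) outside => [<-|xy] outside.
  case: (eqVneq x z) => [xz|xz].
    by rewrite outside ?muln1 // => w wx; rewrite -xz.
  rewrite (bigD1 z) /=; last by rewrite eq_sym.
  rewrite ffunE /= eqxx (negPf xz) outside ?muln1 ?bin1 //.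
  by move=> w /andP[].
rewrite (bigD1 y) /=; last by rewrite eq_sym.
rewrite ffunE /= eqxx (negPf xy).
case: (eqVneq y z) outside => [<-|yz] outside.
  rewrite (eq_sym y x) (negPf xy) outside ?muln1 ?bin1 //.
    by rewrite mulnC.
  by move=> w /andP[].
case: (eqVneq x z) outside => [<-|xz] outside.
  by rewrite outside ?muln1 ?bin1 // => w /andP[].
rewrite (bigD1 z) /=; last by rewrite !(eq_sym z) xz.
rewrite ffunE /= eqxx (negPf xz) (negPf yz) outside ?muln1 ?bin1 ?mulnA //.
by move=> w /andP[/andP[]].
Qed.

(** The cases of [admissible] keep the binomial coefficients non-zero, so the quotients in the
    multiplicity conditions have positive denominators. *)
Lemma gtilde_gt0 (V : finType) (g : V -> nat) x y z :
  (forall x, 0 < g x) -> admissible g x y z -> 0 < gtilde g x y z.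
Proof.
move=> g0 [gxyz gxy gyz gxz]; rewrite /gtilde.
case: (eqVneq x y) => [xy|/eqP xy]; case: (eqVneq y z) => [yz|/eqP yz].
- by rewrite bin_gt0 gxyz.
- by rewrite muln_gt0 bin_gt0 gxy ?g0.
- by rewrite muln_gt0 bin_gt0 gyz ?g0.
- by case: (eqVneq x z) => xz; rewrite !muln_gt0 ?bin_gt0 ?gxz ?g0.
Qed.

(** The starting condition of the iteration, drawn from the hypotheses on multiplicities: if [x]
    occurred more than [g x] times among the three ends of [e], then [g x] would be 1 or 2 and [e]
    would be counted by a multiplicity assumed to be zero. *)
Lemma edge_type_le (V E H : finType) (F : hypergraph V E H) (g : V -> nat) :
  three_hinged F -> (forall x, 0 < g x) ->
  (forall x, g x <= 2 -> mult F x x x = 0) ->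
  (forall x, g x = 1 -> forall y, mult F x x y = 0) ->
  forall e x, edge_type (phi F) (psi F) e x <= g x.
Proof.
move=> hF g0 hg2 hg1 e x; rewrite leqNgt; apply/negP => lt.
have cnt : edge_type (phi F) (psi F) e x =
    count_mem x [seq psi F h | h in hinges F e].
  rewrite count_map count_enum ffunE; congr #|pred_of_set _|.
  by apply/setP=> h; rewrite !inE.
have mult_pos u v w :
    perm_eq [seq psi F h | h in hinges F e] [:: u; v; w] -> mult F u v w <> 0.
  by move=> ps /cards0_eq/setP/(_ e); rewrite !inE ps.
have : size [seq psi F h | h in hinges F e] = 3 by rewrite size_map -cardE hF.
have gx := g0 x; move: cnt mult_pos lt.
case: [seq _ | _ in _] => [|a [|b [|d []]]] //= -> mult_pos lt _.
have mxxx : perm_eq [:: a; b; d] [:: x; x; x] -> 2 < g x.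
  by move=> /mult_pos mx; rewrite ltnNge; apply/negP => /hg2.
have mxxy y : perm_eq [:: a; b; d] [:: x; x; y] -> g x <> 1.
  by move=> /mult_pos mx /hg1.
move: lt mxxx mxxy.
case: (eqVneq a x) => [->|_]; case: (eqVneq b x) => [->|_];
  case: (eqVneq d x) => [->|_]; rewrite /= ?addn0 ?add0n; try lia.
- by move=> lt /(_ (perm_refl _)); lia.
- by move=> lt _ /(_ d (perm_refl _)); lia.
- move=> lt _ /(_ b); have -> : perm_eq [:: x; b; x] [:: x; x; b].
    by rewrite perm_cons; exact: permEl (perm_catC [:: b] [:: x]).
  by move=> /(_ isT); lia.
- move=> lt _ /(_ a); have -> : perm_eq [:: a; x; x] [:: x; x; a].
    exact: permEl (perm_catC [:: a] [:: x; x]).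
  by move=> /(_ isT); lia.
Qed.

End Translation.

(** * Floor and ceiling bounds, and the theorem *)

(** The bound [a] in [shares] is taken to be the floor and then the ceiling of [d / g]; both are
    non-negative, hence natural numbers. *)
Lemma approx_shares (d g d' : nat) : (0 < g)%N -> shares d g d' 1 ->
  approx (d'%:R : rat) (d%:R / g%:R).
Proof.
move=> g0 sh; rewrite /approx.
have gR : 0 < g%:R :> rat by rewrite ltr0n.
have q0 : 0 <= d%:R / g%:R :> rat by rewrite divr_ge0.
apply/andP; split.
  have : 0 <= Num.floor (d%:R / g%:R : rat) by rewrite floor_ge0.
  have := floor_le (d%:R / g%:R : rat).
  case: (Num.floor _) => // n; rewrite ler_pdivlMr // => le _.
  have [+ _] := sh n; rewrite muln1 ler_nat; apply.
  by rewrite -(ler_nat rat) natrM.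
have : 0 <= Num.ceil (d%:R / g%:R : rat) by rewrite ceil_ge0 (lt_le_trans _ q0).
have := ceil_ge (d%:R / g%:R : rat).
case: (Num.ceil _) => // n; rewrite ler_pdivrMr // => le _.
have [_ +] := sh n; rewrite muln1 ler_nat; apply.
by rewrite -(ler_nat rat) natrM.
Qed.

Theorem theorem3p1 (k : nat) (hk : (0 < k)%N) (V E H : finType)
    (F : hypergraph V E H) (c : E -> 'I_k) (hF : three_hinged F)
    (g : V -> nat) (g_pos : forall x : V, (0 < g x)%N)
    (hg2 : forall x : V, (g x <= 2)%N -> mult F x x x = 0%N)
    (hg1 : forall x : V, g x = 1%N -> forall y : V, mult F x x y = 0%N) :
  exists (W : finType) (G : hypergraph W E H) (Psi : W -> V),
    three_uniform G /\
    amalgamation_function G F Psi /\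
    (forall x : V, g x = number_function Psi x) /\
    (forall (x : V) (u : W), Psi u = x ->
       approx ((degree G u)%:R : rat) ((degree F x)%:R / (g x)%:R)) /\
    (forall (x : V) (u : W) (j : 'I_k), Psi u = x ->
       approx ((degree (color_class G c j) u)%:R : rat)
              ((degree (color_class F c j) x)%:R / (g x)%:R)) /\
    (forall x y z : V, admissible g x y z ->
       forall u v w : W, uniq [:: u; v; w] ->
       Psi u = x -> Psi v = y -> Psi w = z ->
       approx ((mult G u v w)%:R : rat)
              ((mult F x y z)%:R / (gtilde g x y z)%:R)) /\
    (forall x y z : V, admissible g x y z ->
       forall u v w : W, uniq [:: u; v; w] ->
       Psi u = x -> Psi v = y -> Psi w = z ->
       forall j : 'I_k,
       approx ((mult (color_class G c j) u v w)%:R : rat)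
              ((mult (color_class F c j) x y z)%:R / (gtilde g x y z)%:R)).
Proof.
have [W [q [Psi [cq wq eq dq mq]]]] :=
  detaches_full c g_pos (edge_type_le hF g_pos hg2 hg1).
pose G := Hypergraph q (phi_surj F).
have numPsi x : g x = number_function Psi x.
  by rewrite wq ffunE sum_nat_const muln1 /number_function -cardsE.
(* Distinctness of [u], [v], [w] bounds their multiset by the constant weight one, as
   [detaches_mult] requires. *)
have mult_shares j u v w : uniq [:: u; v; w] ->
    shares (type_mult (phi F) c (psi F) j (counts [:: Psi u; Psi v; Psi w]))
      (gtilde g (Psi u) (Psi v) (Psi w))
      (type_mult (phi F) c q j (counts [:: u; v; w])) 1.
  move=> uvw; have le x : (counts [:: u; v; w] x <= 1)%N.
    by rewrite ffunE count_uniq_mem // leq_b1.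
  have := mq j _ le; rewrite push_counts type_weight_gtilde.
  suff -> : type_weight (fun=> 1%N) (counts [:: u; v; w]) = 1%N by [].
  by apply: big1 => x _; move: (le x); case: (counts _ x) => [|[]].
exists W, G, Psi; split; [|split; [|split; [|split; [|split; [|split]]]]] => //.
- move=> e; split; last exact: hF.
  rewrite -(hF e); apply: card_in_imset => h1 h2.
  rewrite !inE /= => h1e h2e q12; apply/eqP/negPn/negP => h12.
  (* Two hinges of [e] at the same vertex would exceed its weight one. *)
  have := eq e (q h1); rewrite leqNgt => /negP[].
  rewrite ffunE; apply/card_gt1P; exists h1, h2.
  by rewrite !inE h1e h2e [q h2](esym q12) eqxx.
- split=> // x; have : (0 < number_function Psi x)%N by rewrite -numPsi.
  by case/card_gt0P=> u; rewrite inE => /eqP; exists u.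
(* [in_class] is [true] at [None], so [class_degree] is [degree] by conversion. *)
- by move=> _ u <-; apply: approx_shares (dq None u).
- move=> _ u j <-; rewrite !degree_color_class.
  exact: approx_shares (dq (Some j) u).
- move=> x y z adm u v w uvw ux vy wz; rewrite !(multE _ c).
  rewrite -ux -vy -wz in adm *.
  by apply: approx_shares (mult_shares None _ _ _ uvw); apply: gtilde_gt0.
- move=> x y z adm u v w uvw ux vy wz j; rewrite !mult_color_class.
  rewrite -ux -vy -wz in adm *.
  by apply: approx_shares (mult_shares (Some j) _ _ _ uvw); apply: gtilde_gt0.
Qed.
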